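(* Let $R$ be a commutative ring, $\mathcal C$ a poset, $M$ an $R\mathcal C$-module, and $S\subseteq\mathcal C$ a subset. Then 1) $M$ is $S$-generated if and only if $B_S(M)\subseteq S$; 2) $M$ is $S$-presented if and only if $B_S(M)\cup D_S(M)\subseteq S$.
   Context: A poset $\mathcal C$ is regarded as a category with a unique morphism $c\to d$ iff $c\le d$. An $R\mathcal C$-module is a functor $M\colon\mathcal C\to R\text{-}\mathbf{Mod}$; morphisms are natural transformations; exactness is pointwise. For an $R$-module $A$ and $c\in\mathcal C$, $A[\mathrm{Mor}_{\mathcal C}(c,-)]=A\otimes_RR[\mathrm{Mor}_{\mathcal C}(c,-)]$ (pointwise tensor product). $M$ is $S$-generated if the natural morphism $\bigoplus_{s\in S}M(s)[\mathrm{Mor}_{\mathcal C}(s,-)]\to M$ is an epimorphism; equivalently, the canonical map $\mathrm{colim}_{d\in S,\,d\le c}M(d)\to M(c)$ is an epimorphism for all $c\in\mathcal C$. $M$ is $S$-presented if the canonical map $\mathrm{colim}_{d\in S,\,d\le c}M(d)\to M(c)$ is an isomorphism for all $c\in\mathcal C$; equivalently, there is an exact sequence $\bigoplus_{s\in S}B_s[\mathrm{Mor}_{\mathcal C}(s,-)]\to\bigoplus_{s\in S}A_s[\mathrm{Mor}_{\mathcal C}(s,-)]\to M\to0$ with $R$-modules $A_s,B_s$. For $c\in\mathcal C$, let $\lambda_{M,c}\colon\mathrm{colim}_{d<c,\ d\in S}M(d)\to M(c)$ be the natural homomorphism. The set of births relative to $S$ is $B_S(M)=\{c\in\mathcal C\mid\lambda_{M,c}\text{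 is not an epimorphism}\}$ and the set of deaths relative to $S$ is $D_S(M)=\{c\in\mathcal C\mid\lambda_{M,c}\text{ is not a monomorphism}\}$. *)

(* Defs.v *)
From HB Require Import structures.
From mathcomp Require Import all_boot all_order all_algebra.
From mathcomp Require Import finmap all_classical.
Set Implicit Arguments.
Unset Strict Implicit.
Unset Printing Implicit Defensive.
Import Order.TTheory GRing.Theory.
Local Open Scope classical_set_scope.
Local Open Scope ring_scope.

Definition mkLinear (R : pzRingType) (U V : lmodType R) (f : U -> V)
    (f_lin : linear f) : {linear U -> V} :=
  HB.pack f (GRing.isLinear.Build R U V *:%R f f_lin).

Section CategoryOfModules.
Variable R : pzRingType.
Implicit Types U V : lmodType R.

Definition epi U V (f : {linear U -> V}) : Prop :=
  forall (W : lmodType R) (g h : {linear V -> W}), g \o f =1 h \o f -> g =1 h.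

Definition mono U V (f : {linear U -> V}) : Prop :=
  forall (W : lmodType R) (g h : {linear W -> U}), f \o g =1 f \o h -> g =1 h.

Definition iso U V (f : {linear U -> V}) : Prop :=
  exists g : {linear V -> U}, cancel f g /\ cancel g f.

End CategoryOfModules.

Section QuotientModule.
Variables (R : pzRingType) (V : lmodType R).

Definition submodule_set (P : set V) : Prop :=
  P 0 /\ forall a u v, P u -> P v -> P (a *: u + v).

Definition spanned (G : set V) : {pred V} :=
  fun v => `[< forall P : set V, submodule_set P -> G `<=` P -> P v >].

Variable G : set V.

Lemma spanned_gen g : G g -> g \in spanned G.
Proof. by move=> Gg; apply/asboolP => P _; apply. Qed.

Lemma spanned_linear a u v :
  u \in spanned G -> v \in spanned G -> a *: u + v \in spanned G.
Proof.
move=> /asboolP uG /asboolP vG; apply/asboolP => P Psub GP.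
by apply: Psub.2; [exact: uG | exact: vG].
Qed.

Lemma spanned_zmod_closed : zmod_closed (spanned G).
Proof.
split=> [|u v uG vG]; first by apply/asboolP => P [].
by rewrite addrC -scaleN1r; apply: spanned_linear.
Qed.
HB.instance Definition _ := GRing.isZmodClosed.Build V (spanned G) spanned_zmod_closed.

Lemma spanned_scale a u : u \in spanned G -> a *: u \in spanned G.
Proof. by move=> uG; rewrite -[_ *: _]addr0 spanned_linear // rpred0. Qed.

(* V modulo the submodule generated by G *)
Definition modquot : Type := Quotient.quot (spanned G).
HB.instance Definition _ := GRing.Zmodule.on modquot.

Definition quot_pi (v : V) : modquot := \pi_(Quotient.quot (spanned G))%qT v.
Definition quot_repr (x : modquot) : V := repr (x : Quotient.quot (spanned G)).

Lemma quot_piP u v : quot_pi u = quot_pi v <-> u - v \in spanned G.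
Proof. by rewrite Quotient.idealrBE; split => /eqP. Qed.

Lemma quot_reprK : cancel quot_repr quot_pi.
Proof. exact: reprK. Qed.

Lemma quot_piB u v : quot_pi (u - v) = quot_pi u - quot_pi v.
Proof. exact: (raddfB (\pi_(Quotient.quot (spanned G))%qT)). Qed.

Lemma quot_piD u v : quot_pi (u + v) = quot_pi u + quot_pi v.
Proof. exact: (raddfD (\pi_(Quotient.quot (spanned G))%qT)). Qed.

Definition quot_scale a (x : modquot) : modquot := quot_pi (a *: quot_repr x).

Lemma quot_scale_pi a v : quot_scale a (quot_pi v) = quot_pi (a *: v).
Proof.
apply/quot_piP; rewrite -scalerBr; apply/spanned_scale/quot_piP.
by rewrite quot_reprK.
Qed.

Lemma quot_scaleA a b x : quot_scale a (quot_scale b x) = quot_scale (a * b) x.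
Proof. by rewrite -[x]quot_reprK !quot_scale_pi scalerA. Qed.

Lemma quot_scale1 : left_id 1 quot_scale.
Proof. by move=> x; rewrite -[x]quot_reprK quot_scale_pi scale1r. Qed.

Lemma quot_scaleDr : right_distributive quot_scale +%R.
Proof.
move=> a x y; rewrite -[x]quot_reprK -[y]quot_reprK -quot_piD.
by rewrite !quot_scale_pi scalerDr quot_piD.
Qed.

Lemma quot_scaleDl x : {morph quot_scale^~ x : a b / a + b}.
Proof.
by move=> a b; rewrite -[x]quot_reprK !quot_scale_pi scalerDl quot_piD.
Qed.
HB.instance Definition _ := GRing.Zmodule_isLmodule.Build R modquot
  quot_scaleA quot_scale1 quot_scaleDr quot_scaleDl.

Lemma quot_pi_is_linear : linear quot_pi.
Proof. by move=> a u v; rewrite quot_piD -quot_scale_pi. Qed.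
HB.instance Definition _ :=
  GRing.isLinear.Build R V modquot *:%R quot_pi quot_pi_is_linear.

Lemma quot_ext (W : Type) (f g : modquot -> W) :
  (forall v, f (quot_pi v) = g (quot_pi v)) -> f =1 g.
Proof. by move=> fg x; rewrite -[x]quot_reprK fg. Qed.

Section Lift.
Variables (W : lmodType R) (f : {linear V -> W}).
Hypothesis fG : forall g, G g -> f g = 0.

Lemma spanned_ker v : v \in spanned G -> f v = 0.
Proof.
move=> /asboolP /(_ [set u | f u = 0]); apply; last exact: fG.
split=> [|a u w /= fu fw]; first by rewrite /= raddf0.
by rewrite linearP fu fw scaler0 addr0.
Qed.

Definition quot_lift_fun (x : modquot) : W := f (quot_repr x).

Lemma quot_lift_fun_pi v : quot_lift_fun (quot_pi v) = f v.
Proof.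
apply/eqP; rewrite -subr_eq0 -raddfB; apply/eqP/spanned_ker/quot_piP.
by rewrite quot_reprK.
Qed.

Lemma quot_lift_is_linear : linear quot_lift_fun.
Proof.
move=> a x y; rewrite -[x]quot_reprK -[y]quot_reprK -linearP.
by rewrite !quot_lift_fun_pi linearP.
Qed.

Definition quot_lift : {linear modquot -> W} := mkLinear quot_lift_is_linear.

Lemma quot_lift_pi v : quot_lift (quot_pi v) = f v.
Proof. exact: quot_lift_fun_pi. Qed.

End Lift.
End QuotientModule.

Section DirectSum.
Variables (R : pzRingType) (I : choiceType) (M : I -> lmodType R).

Definition supp (f : forall i, M i) : set I := [set i | f i != 0].

Record dsum : Type := DSum {
  dsum_val :> forall i, M i;
  dsum_fin : finite_set (supp dsum_val) }.

HB.instance Definition _ := gen_eqMixin dsum.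
HB.instance Definition _ := gen_choiceMixin dsum.

Lemma dsum_eqP (f g : dsum) : (forall i, f i = g i) -> f = g.
Proof.
case: f g => [f ff] [g fg] /= fgE.
have {fgE} efg : f = g by exact: functional_extensionality_dep.
by subst g; congr DSum; exact: Prop_irrelevance.
Qed.

Lemma dsum0_fin : finite_set (supp (fun i => 0)).
Proof.
apply: (sub_finite_set _ (@finite_set0 I)) => i.
by rewrite /supp /= eqxx.
Qed.

Lemma dsumP_fin a (f g : dsum) : finite_set (supp (fun i => a *: f i + g i)).
Proof.
have fin : finite_set (supp f `|` supp g).
  by rewrite finite_setU; split; exact: dsum_fin.
apply: sub_finite_set fin => i; rewrite /supp /=.
have [->|] := eqVneq (f i) 0; last by left.
by rewrite scaler0 add0r; right.
Qed.

Definition dsum_zero : dsum := DSum dsum0_fin.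

Definition dsum_lin a (f g : dsum) : dsum := DSum (dsumP_fin a f g).
Definition dsum_add (f g : dsum) : dsum := dsum_lin 1 f g.
Definition dsum_opp (f : dsum) : dsum := dsum_lin (- 1) f dsum_zero.
Definition dsum_scale a (f : dsum) : dsum := dsum_lin a f dsum_zero.

Lemma dsum_addA : associative dsum_add.
Proof. by move=> f g h; apply: dsum_eqP => i; rewrite /= !scale1r addrA. Qed.

Lemma dsum_addC : commutative dsum_add.
Proof. by move=> f g; apply: dsum_eqP => i; rewrite /= !scale1r addrC. Qed.

Lemma dsum_add0 : left_id dsum_zero dsum_add.
Proof. by move=> f; apply: dsum_eqP => i; rewrite /= scaler0 add0r. Qed.

Lemma dsum_addN : left_inverse dsum_zero dsum_opp dsum_add.
Proof.
by move=> f; apply: dsum_eqP => i; rewrite /= scale1r scaleN1r addr0 addNr.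
Qed.
HB.instance Definition _ :=
  GRing.isZmodule.Build dsum dsum_addA dsum_addC dsum_add0 dsum_addN.

Lemma dsum_scaleA a b f : dsum_scale a (dsum_scale b f) = dsum_scale (a * b) f.
Proof. by apply: dsum_eqP => i; rewrite /= !addr0 scalerA. Qed.

Lemma dsum_scale1 : left_id 1 dsum_scale.
Proof. by move=> f; apply: dsum_eqP => i; rewrite /= addr0 scale1r. Qed.

Lemma dsum_scaleDr : right_distributive dsum_scale +%R.
Proof.
by move=> a f g; apply: dsum_eqP => i; rewrite /= !addr0 !scale1r scalerDr.
Qed.

Lemma dsum_scaleDl f : {morph dsum_scale^~ f : a b / a + b}.
Proof.
by move=> a b; apply: dsum_eqP => i; rewrite /= !addr0 scale1r scalerDl.
Qed.
HB.instance Definition _ := GRing.Zmodule_isLmodule.Build R dsum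
  dsum_scaleA dsum_scale1 dsum_scaleDr dsum_scaleDl.

Lemma dsum_valP a (f g : dsum) i : (a *: f + g) i = a *: f i + g i.
Proof. by rewrite /= addr0 scale1r. Qed.

Section Injection.
Variable i : I.

Lemma dsum_in_fin (x : M i) : finite_set (supp (dfwith (fun j => 0 : M j) i x)).
Proof.
apply: (sub_finite_set _ (finite_set1 i)) => j; rewrite /supp /=.
by have [<-//|ij] := eqVneq i j; rewrite dfwithout ?eqxx.
Qed.

Definition dsum_in_fun (x : M i) : dsum := DSum (dsum_in_fin x).

Lemma dsum_in_is_linear : linear dsum_in_fun.
Proof.
move=> a x y; apply: dsum_eqP => j; rewrite dsum_valP /=.
case: (eqVneq i j) => [ij|ij]; first by subst j; rewrite !dfwithin.
by rewrite !dfwithout // scaler0 addr0.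
Qed.

Definition dsum_in : {linear M i -> dsum} := mkLinear dsum_in_is_linear.

End Injection.

Section Lift.
Variables (W : lmodType R) (phi : forall i, {linear M i -> W}).

Definition dsum_lift_fun (f : dsum) : W := \sum_(i \in supp f) phi i (f i).

Lemma dsum_lift_widen (D : set I) (f : dsum) :
  supp f `<=` D -> dsum_lift_fun f = \sum_(i \in D) phi i (f i).
Proof.
move=> fD; apply: fsbig_widen => // i [_ /= nfi].
by move/negP: nfi; rewrite negbK => /eqP ->; rewrite raddf0.
Qed.

Lemma dsum_lift_is_linear : linear dsum_lift_fun.
Proof.
move=> a f g; pose D := supp f `|` supp g.
have finD : finite_set D by rewrite finite_setU; split; exact: dsum_fin.
rewrite (@dsum_lift_widen D f); last by move=> i; left.
rewrite (@dsum_lift_widen D g); last by move=> i; right.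
rewrite (@dsum_lift_widen D); last first.
  move=> i; rewrite /supp /mkset dsum_valP.
  have [fi0|] := eqVneq (f i) 0; last by left.
  by rewrite fi0 scaler0 add0r; right.
rewrite !fsbig_finite //= scaler_sumr -big_split /=.
by apply: eq_bigr => i _; rewrite addr0 scale1r linearP.
Qed.

Definition dsum_lift : {linear dsum -> W} := mkLinear dsum_lift_is_linear.

Lemma dsum_lift_in i (x : M i) : dsum_lift (dsum_in i x) = phi i x.
Proof.
rewrite [LHS](@dsum_lift_widen [set i]) ?fsbig_set1 /= ?dfwithin // => j.
rewrite /supp /=.
by have [<-//|ij] := eqVneq i j; rewrite dfwithout ?eqxx.
Qed.

End Lift.

Lemma dsum_decomp (f : dsum) :
  f = \sum_(i <- fset_set (supp f)) dsum_in i (f i).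
Proof.
apply: dsum_eqP => j.
pose ev : {linear dsum -> M j} := mkLinear (fun a f g => dsum_valP a f g j).
rewrite -[RHS]/(ev _) raddf_sum.
have [fj0|fj] := eqVneq (f j) 0.
  rewrite fj0 big1_seq // => i _ /=.
  have [ij|ij] := eqVneq i j; last by rewrite dfwithout.
  by subst i; rewrite dfwithin.
have jf : j \in fset_set (supp f).
  by rewrite in_fset_set ?mem_set //; exact: dsum_fin.
rewrite (big_fsetD1 j) //= dfwithin big1_seq ?addr0 // => i /andP[_].
by rewrite !inE => /andP[ij _]; rewrite dfwithout.
Qed.

Lemma dsum_ext (W : lmodType R) (f g : {linear dsum -> W}) :
  (forall i (x : M i), f (dsum_in i x) = g (dsum_in i x)) -> f =1 g.
Proof.
by move=> fg x; rewrite (dsum_decomp x) !raddf_sum; apply: eq_bigr => i _; exact: fg.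
Qed.

End DirectSum.

Arguments dsum_in {R I M} i.

Definition freemod (R : pzRingType) (X : choiceType) : lmodType R :=
  @dsum R X (fun _ => R^o).

Definition basis (R : pzRingType) (X : choiceType) (x : X) : freemod R X :=
  @dsum_in R X (fun _ => R^o) x 1.

Section FreeModule.
Variables (R : pzRingType) (X : choiceType) (V : lmodType R).

Lemma scale_to_is_linear (v : V) : linear (fun a : R^o => (a : R) *: v).
Proof. by move=> a b c; rewrite scalerDl scalerA. Qed.

Definition free_lift (f : X -> V) : {linear freemod R X -> V} :=
  dsum_lift (fun x => mkLinear (scale_to_is_linear (f x))).

Lemma free_lift_basis f x : free_lift f (basis R x) = f x.
Proof. by rewrite /free_lift dsum_lift_in /= scale1r. Qed.

Lemma free_ext (f g : {linear freemod R X -> V}) :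
  (forall x, f (basis R x) = g (basis R x)) -> f =1 g.
Proof.
move=> fg; apply: dsum_ext => x a.
have -> : dsum_in x a = (a : R) *: basis R x.
  rewrite /basis -linearZ; congr (dsum_in_fun (M := fun _ => R^o) _).
  by rewrite -[LHS]mulr1.
by rewrite !linearZ fg.
Qed.

End FreeModule.

Section TensorProduct.
Variables (R : comPzRingType) (A B : lmodType R).

Let symb (a : A) (b : B) : freemod R (A * B)%type := basis R (a, b).

Inductive tensor_rel : freemod R (A * B)%type -> Prop :=
| TensorDl a a' b : tensor_rel (symb (a + a') b - (symb a b + symb a' b))
| TensorDr a b b' : tensor_rel (symb a (b + b') - (symb a b + symb a b'))
| TensorZl r a b : tensor_rel (symb (r *: a) b - r *: symb a b)
| TensorZr r a b : tensor_rel (symb a (r *: b) - r *: symb a b).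

Definition tensor : lmodType R := modquot tensor_rel.

Definition pure (a : A) (b : B) : tensor := quot_pi tensor_rel (symb a b).

Lemma pure_linearl b : linear (pure^~ b).
Proof.
have pD a a' : pure (a + a') b = pure a b + pure a' b.
  rewrite /pure -raddfD; apply/quot_piP; apply: spanned_gen; exact: TensorDl.
have pZ r a : pure (r *: a) b = r *: pure a b.
  rewrite /pure -linearZ; apply/quot_piP; apply: spanned_gen; exact: TensorZl.
by move=> r a a'; rewrite pD pZ.
Qed.

Lemma pure_linearr a : linear (pure a).
Proof.
have pD b b' : pure a (b + b') = pure a b + pure a b'.
  rewrite /pure -raddfD; apply/quot_piP; apply: spanned_gen; exact: TensorDr.
have pZ r b : pure a (r *: b) = r *: pure a b.
  rewrite /pure -linearZ; apply/quot_piP; apply: spanned_gen; exact: TensorZr.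
by move=> r b b'; rewrite pD pZ.
Qed.

Lemma tensor_ext (V : lmodType R) (f g : {linear tensor -> V}) :
  (forall a b, f (pure a b) = g (pure a b)) -> f =1 g.
Proof.
move=> fg; apply: quot_ext.
pose fp : {linear _ -> V} := f \o quot_pi tensor_rel.
pose gp : {linear _ -> V} := g \o quot_pi tensor_rel.
by apply: (free_ext (f := fp) (g := gp)) => -[a b]; exact: fg.
Qed.

Section Lift.
Variables (V : lmodType R) (f : A -> B -> V).
Hypotheses (fl : forall b, linear (f^~ b)) (fr : forall a, linear (f a)).

Lemma tensor_lift_rel t :
  tensor_rel t -> free_lift (fun ab : A * B => f ab.1 ab.2) t = 0.
Proof.
set L := free_lift _.
have LE a b : L (basis R (a, b)) = f a b by rewrite [LHS]free_lift_basis.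
have LB x y : L x = L y -> L (x - y) = 0.
  by move=> xy; apply/eqP; rewrite raddfB subr_eq0; exact/eqP.
have LD x y : L (x + y) = L x + L y by rewrite raddfD.
have LZ r x : L (r *: x) = r *: L x by rewrite linearZ.
pose fl' b := mkLinear (fl b); pose fr' a := mkLinear (fr a).
case=> [a a' b|a b b'|r a b|r a b]; apply: LB; rewrite ?LD ?LZ !LE.
- exact: (raddfD (fl' b)).
- exact: (raddfD (fr' a)).
- exact: (linearZ_LR (fl' b)).
- exact: (linearZ_LR (fr' a)).
Qed.

Definition tensor_lift : {linear tensor -> V} := quot_lift tensor_lift_rel.

Lemma tensor_lift_pure a b : tensor_lift (pure a b) = f a b.
Proof. by rewrite /tensor_lift /pure quot_lift_pi free_lift_basis. Qed.

End Lift.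
End TensorProduct.

Section Modules.
Variables (R : comPzRingType) (disp : Order.disp_t) (C : porderType disp).

Record rcmod : Type := RCMod {
  rc_obj :> C -> lmodType R;
  rc_map : forall c d, (c <= d)%O -> {linear rc_obj c -> rc_obj d};
  rc_map_id : forall c (cc : (c <= c)%O), rc_map cc =1 id;
  rc_map_comp : forall c d e (cd : (c <= d)%O) (de : (d <= e)%O)
    (ce : (c <= e)%O), rc_map ce =1 rc_map de \o rc_map cd }.

Record rchom (M N : rcmod) : Type := RCHom {
  rchom_fun :> forall c, {linear M c -> N c};
  rchom_nat : forall c d (cd : (c <= d)%O),
    rchom_fun d \o rc_map M cd =1 rc_map N cd \o rchom_fun c }.

Definition rc_epi (M N : rcmod) (f : rchom M N) : Prop :=
  forall (P : rcmod) (g h : rchom N P),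
    (forall c, g c \o f c =1 h c \o f c) -> forall c, g c =1 h c.

Section FreeHom.
Variable c : C.

(* The choiceType of morphisms from c to d: it has exactly one element when
   c <= d and none otherwise. *)
Definition Mor (d : C) : choiceType := {classic (c <= d)%O}.

Definition free_Mor_map d e (de : (d <= e)%O) :
    {linear freemod R (Mor d) -> freemod R (Mor e)} :=
  free_lift (fun cd : Mor d => basis R (le_trans cd de : Mor e)).

Lemma free_Mor_map_basis d e (de : (d <= e)%O) (cd : Mor d) :
  free_Mor_map de (basis R cd) = basis R (le_trans cd de : Mor e).
Proof. exact: free_lift_basis. Qed.

Lemma free_Mor_map_id d (dd : (d <= d)%O) : free_Mor_map dd =1 id.
Proof.
apply: (free_ext (g := idfun)) => cd.
by rewrite free_Mor_map_basis; congr basis; exact: bool_irrelevance.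
Qed.

Lemma free_Mor_map_comp d e f (de : (d <= e)%O) (ef : (e <= f)%O)
    (df : (d <= f)%O) : free_Mor_map df =1 free_Mor_map ef \o free_Mor_map de.
Proof.
apply: (free_ext (g := free_Mor_map ef \o free_Mor_map de)) => cd.
rewrite -[RHS]/(free_Mor_map ef (free_Mor_map de (basis R cd))).
by rewrite !free_Mor_map_basis; congr basis; exact: bool_irrelevance.
Qed.

Definition free_Mor : rcmod := RCMod free_Mor_map_id free_Mor_map_comp.

End FreeHom.

Section PointwiseTensor.
Variables (A : lmodType R) (F : rcmod).

Lemma ptensor_lin2 d e (de : (d <= e)%O) (a : A) :
  linear (fun x : F d => pure a (rc_map F de x)).
Proof. by move=> r x y; rewrite linearP; exact: pure_linearr. Qed.

Definition ptensor_map d e (de : (d <= e)%O) :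
    {linear tensor A (F d) -> tensor A (F e)} :=
  tensor_lift (f := fun a x => pure a (rc_map F de x))
    (fun x => pure_linearl (rc_map F de x)) (ptensor_lin2 de).

Lemma ptensor_map_pure d e (de : (d <= e)%O) (a : A) (x : F d) :
  ptensor_map de (pure a x) = pure a (rc_map F de x).
Proof. exact: tensor_lift_pure. Qed.

Lemma ptensor_map_id d (dd : (d <= d)%O) : ptensor_map dd =1 id.
Proof.
apply: (tensor_ext (g := idfun)) => a x.
by rewrite ptensor_map_pure rc_map_id.
Qed.

Lemma ptensor_map_comp d e f (de : (d <= e)%O) (ef : (e <= f)%O)
    (df : (d <= f)%O) : ptensor_map df =1 ptensor_map ef \o ptensor_map de.
Proof.
apply: (tensor_ext (g := ptensor_map ef \o ptensor_map de)) => a x.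
rewrite -[RHS]/(ptensor_map ef (ptensor_map de (pure a x))).
by rewrite !ptensor_map_pure (rc_map_comp de ef).
Qed.

Definition ptensor : rcmod := RCMod ptensor_map_id ptensor_map_comp.

End PointwiseTensor.

Section PointwiseDirectSum.
Variables (I : choiceType) (F : I -> rcmod).

Definition pdsum_map d e (de : (d <= e)%O) :
    {linear dsum (fun i => F i d) -> dsum (fun i => F i e)} :=
  dsum_lift (fun i => dsum_in (M := fun i => F i e) i \o rc_map (F i) de).

Lemma pdsum_map_in d e (de : (d <= e)%O) i (x : F i d) :
  pdsum_map de (dsum_in i x) = dsum_in i (rc_map (F i) de x).
Proof. exact: dsum_lift_in. Qed.

Lemma pdsum_map_id d (dd : (d <= d)%O) : pdsum_map dd =1 id.
Proof.
apply: (dsum_ext (g := idfun)) => i x.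
by rewrite pdsum_map_in rc_map_id.
Qed.

Lemma pdsum_map_comp d e f (de : (d <= e)%O) (ef : (e <= f)%O)
    (df : (d <= f)%O) : pdsum_map df =1 pdsum_map ef \o pdsum_map de.
Proof.
apply: (dsum_ext (g := pdsum_map ef \o pdsum_map de)) => i x.
rewrite -[RHS]/(pdsum_map ef (pdsum_map de (dsum_in i x))).
by rewrite !pdsum_map_in (rc_map_comp de ef).
Qed.

Definition pdsum : rcmod :=
  @RCMod (fun d => dsum (fun i => F i d)) pdsum_map pdsum_map_id pdsum_map_comp.

End PointwiseDirectSum.

Variables (M : rcmod) (S : set C).

Section Generation.

(* The direct sum over s in S of M(s)[Mor(s,-)] = M(s) (x) R[Mor(s,-)] *)
Definition generators : rcmod :=
  pdsum (fun s : S => ptensor (M (val s)) (free_Mor (val s))).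

Section Component.
Variables (s c : C).

Definition gen_eval (x : M s) : {linear free_Mor s c -> M c} :=
  free_lift (fun sc : Mor s c => rc_map M sc x).

Lemma gen_eval_basis x (sc : Mor s c) : gen_eval x (basis R sc) = rc_map M sc x.
Proof. exact: free_lift_basis. Qed.

Lemma gen_eval_linear u : linear (gen_eval^~ u).
Proof.
move=> r x y.
apply: (free_ext (g := (r \*: gen_eval x) \+ gen_eval y)) => sc.
rewrite -[RHS]/(r *: gen_eval x (basis R sc) + gen_eval y (basis R sc)).
by rewrite !gen_eval_basis linearP.
Qed.

Definition gen_component : {linear tensor (M s) (free_Mor s c) -> M c} :=
  tensor_lift gen_eval_linear (fun x => linearP (gen_eval x)).

Lemma gen_component_pure x (sc : Mor s c) :
  gen_component (pure x (basis R sc)) = rc_map M sc x.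
Proof. by rewrite [LHS]tensor_lift_pure gen_eval_basis. Qed.

End Component.

Definition gen_map c : {linear generators c -> M c} :=
  dsum_lift (fun s : S => gen_component (val s) c).

Definition generator (s : S) c (x : M (val s)) (sc : Mor (val s) c) :
    generators c :=
  dsum_in (M := fun s : S => tensor (M (val s)) (free_Mor (val s) c))
    s (pure x (basis R sc)).

Lemma gen_map_generator (s : S) c x (sc : Mor (val s) c) :
  gen_map c (generator x sc) = rc_map M sc x.
Proof. by rewrite [LHS]dsum_lift_in gen_component_pure. Qed.

Lemma rc_map_generator (s : S) c d (cd : (c <= d)%O) x (sc : Mor (val s) c) :
  rc_map generators cd (generator x sc) =
  generator x (le_trans sc cd : Mor (val s) d).
Proof.
rewrite [LHS]pdsum_map_in [rc_map _ _ _]ptensor_map_pure.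
by rewrite [rc_map _ _ _]free_Mor_map_basis.
Qed.

Lemma generators_ext c (V : lmodType R) (f g : {linear generators c -> V}) :
  (forall (s : S) x (sc : Mor (val s) c),
     f (generator x sc) = g (generator x sc)) -> f =1 g.
Proof.
move=> fg; apply: dsum_ext => s.
pose i : {linear _ -> generators c} :=
  dsum_in (M := fun s : S => tensor (M (val s)) (free_Mor (val s) c)) s.
apply: (tensor_ext (f := f \o i) (g := g \o i)) => x.
pose j : {linear free_Mor (val s) c -> _} := i \o mkLinear (pure_linearr x).
by apply: (free_ext (f := f \o j) (g := g \o j)) => sc; exact: fg.
Qed.

Lemma gen_map_nat c d (cd : (c <= d)%O) :
  gen_map d \o rc_map generators cd =1 rc_map M cd \o gen_map c.
Proof.
apply: (generators_ext (f := gen_map d \o rc_map generators cd)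
                       (g := rc_map M cd \o gen_map c)) => s x sc.
rewrite -[LHS]/(gen_map d (rc_map generators cd (generator x sc))).
rewrite -[RHS]/(rc_map M cd (gen_map c (generator x sc))).
by rewrite rc_map_generator !gen_map_generator (rc_map_comp sc cd).
Qed.

Definition gen_hom : rchom generators M := RCHom gen_map_nat.

Definition S_generated : Prop := rc_epi gen_hom.

End Generation.

Section Colimit.
Variable D : set C.

(* colim is the colimit of the restriction of M to the full subposet D *)
Definition colim_rel : set (dsum (fun d : D => M (val d))) :=
  [set v | exists (d e : D) (de : (val d <= val e)%O) (x : M (val d)),
     v = dsum_in d x - dsum_in e (rc_map M de x)].

Definition colim : lmodType R := modquot colim_rel.

Definition colim_in (d : D) : {linear M (val d) -> colim} :=
  quot_pi colim_rel \o dsum_in (M := fun d : D => M (val d)) d.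

Lemma colim_in_nat (d e : D) (de : (val d <= val e)%O) :
  colim_in e \o rc_map M de =1 colim_in d.
Proof.
move=> x; apply/esym/quot_piP; apply: spanned_gen; by exists d, e, de, x.
Qed.

Lemma colim_ext (V : lmodType R) (f g : {linear colim -> V}) :
  (forall d, f \o colim_in d =1 g \o colim_in d) -> f =1 g.
Proof.
move=> fg; apply: quot_ext.
exact: (dsum_ext (f := f \o quot_pi colim_rel) (g := g \o quot_pi colim_rel)).
Qed.

Section Lift.
Variables (V : lmodType R) (phi : forall d : D, {linear M (val d) -> V}).
Hypothesis phi_nat : forall (d e : D) (de : (val d <= val e)%O),
  phi e \o rc_map M de =1 phi d.

Lemma colim_lift_rel v : colim_rel v -> dsum_lift phi v = 0.
Proof.
case=> d [e [de [x ->]]]; apply/eqP; rewrite raddfB subr_eq0; apply/eqP.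
rewrite [LHS](dsum_lift_in phi) [RHS](dsum_lift_in phi).
exact/esym/phi_nat.
Qed.

Definition colim_lift : {linear colim -> V} := quot_lift colim_lift_rel.

Lemma colim_lift_in d x : colim_lift (colim_in d x) = phi d x.
Proof. by rewrite /colim_lift quot_lift_pi dsum_lift_in. Qed.

End Lift.

Section CanonicalMap.
Variable c : C.
Hypothesis Dc : forall d, D d -> (d <= c)%O.

Definition colim_leg (d : D) : {linear M (val d) -> M c} :=
  rc_map M (Dc (set_mem (valP d))).

Lemma colim_leg_nat (d e : D) (de : (val d <= val e)%O) :
  colim_leg e \o rc_map M de =1 colim_leg d.
Proof. by move=> x; apply/esym/rc_map_comp. Qed.

Definition colim_to : {linear colim -> M c} := colim_lift colim_leg_nat.

End CanonicalMap.
End Colimit.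

Definition below (c : C) : set C := [set d | S d /\ (d <= c)%O].
Definition strictly_below (c : C) : set C := [set d | (d < c)%O /\ S d].

Lemma below_le c d : below c d -> (d <= c)%O.
Proof. by case. Qed.

Lemma strictly_below_le c d : strictly_below c d -> (d <= c)%O.
Proof. by case=> /ltW. Qed.

Definition S_presented : Prop := forall c, iso (colim_to (@below_le c)).

Definition lambda (c : C) : {linear colim (strictly_below c) -> M c} :=
  colim_to (@strictly_below_le c).

Definition births : set C := [set c | ~ epi (lambda c)].
Definition deaths : set C := [set c | ~ mono (lambda c)].

End Modules.

(* Main.v *)
(** If [c] is in [S], then [c] is a greatest element of [below S c], so the
colimit over [below S c] is [M c] and nothing is required at [c].  If [c] is
not in [S], then [below S c] and [strictly_below S c] coincide, so the canonical
map at [c] is [lambda M S c].  Epimorphisms of functors are detected pointwise,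
by means of the pointwise cokernel. *)
Require Import Defs.
From HB Require Import structures.
From mathcomp Require Import all_boot all_order all_algebra.
From mathcomp Require Import finmap all_classical.
Set Implicit Arguments.
Unset Strict Implicit.
Unset Printing Implicit Defensive.
Import Order.TTheory GRing.Theory.
Local Open Scope classical_set_scope.
Local Open Scope ring_scope.

Section LinearMaps.
Variable R : pzRingType.
Implicit Types U V W : lmodType R.

(** The range of a linear map is already a submodule, so spanning adds nothing to it. *)
Lemma spanned_range U V (f : {linear U -> V}) y :
  y \in spanned (range f) -> exists x, f x = y.
Proof.
move=> /asboolP /(_ (range f)) []; last 2 first.
- exact: subset_refl.
- by move=> x _ <-; exists x.
split=> [|a _ _ [x _ <-] [x' _ <-]]; first by exists 0; rewrite ?raddf0.
by exists (a *: x + x'); rewrite ?linearP.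
Qed.

Lemma epiP U V (f : {linear U -> V}) : epi f <-> forall y, exists x, f x = y.
Proof.
split=> [ef y|sf W g h gh y]; last by have [x <-] := sf y; exact: gh.
(* Compare the quotient map onto the cokernel of [f] with the zero map: they agree after [f], so [y]
   has class zero. *)
apply: spanned_range; rewrite -[y]subr0; apply/quot_piP; rewrite raddf0.
apply: (ef _ (quot_pi (range f)) \0) => x.
rewrite /= -[RHS](raddf0 (quot_pi (range f))); apply/quot_piP.
by rewrite subr0; apply: spanned_gen; exists x.
Qed.

(** Elements of [U] are linear maps out of [R^o], so [mono] is tested on those sending 1 to [x] and
    to [y]. *)
Lemma mono_inj U V (f : {linear U -> V}) : mono f -> injective f.
Proof.
move=> mf x y fxy.
have := mf R^o (mkLinear (scale_to_is_linear x))
  (mkLinear (scale_to_is_linear y)).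
move=> /(_ _ 1); rewrite /= !scale1r; apply=> a /=.
by rewrite !linearZ fxy.
Qed.

Lemma iso_mono U V (f : {linear U -> V}) : iso f -> mono f.
Proof. by move=> [k [fK _]] W g h gh x; apply: (can_inj fK); exact: gh. Qed.

Lemma iso_epi U V (f : {linear U -> V}) : iso f -> epi f.
Proof. by move=> [k [_ kK]]; apply/epiP => y; exists (k y). Qed.

(** Surjectivity gives a section by choice; injectivity makes it linear and a two-sided inverse. *)
Lemma mono_epi_iso U V (f : {linear U -> V}) : mono f -> epi f -> iso f.
Proof.
move=> /mono_inj f_inj /epiP /choice[k kK].
have k_lin : linear k.
  by move=> a u v; apply: f_inj; rewrite linearP !kK.
by exists (mkLinear k_lin); split=> // x; apply: f_inj; exact: kK.
Qed.

End LinearMaps.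

Section Functors.
Variables (R : comPzRingType) (disp : Order.disp_t) (C : porderType disp).

Section Cokernel.
Variables (M N : rcmod R C) (f : rchom M N).

Lemma coker_map_range c d (cd : (c <= d)%O) y :
  range (f c) y -> (quot_pi (range (f d)) \o rc_map N cd) y = 0.
Proof.
case=> x _ <-; rewrite -[LHS]/(quot_pi _ ((rc_map N cd \o f c) x)).
rewrite -(rchom_nat f cd) -(raddf0 (quot_pi (range (f d)))); apply/quot_piP.
by rewrite subr0; apply: spanned_gen; exists (rc_map M cd x).
Qed.

Definition coker_map c d (cd : (c <= d)%O) :
    {linear modquot (range (f c)) -> modquot (range (f d))} :=
  quot_lift (coker_map_range cd).

Lemma coker_map_pi c d (cd : (c <= d)%O) y :
  coker_map cd (quot_pi (range (f c)) y) =
  quot_pi (range (f d)) (rc_map N cd y).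
Proof. exact: quot_lift_pi. Qed.

Lemma coker_map_id c (cc : (c <= c)%O) : coker_map cc =1 id.
Proof. by apply: quot_ext => y; rewrite coker_map_pi rc_map_id. Qed.

Lemma coker_map_comp c d e (cd : (c <= d)%O) (de : (d <= e)%O)
    (ce : (c <= e)%O) : coker_map ce =1 coker_map de \o coker_map cd.
Proof.
apply: quot_ext => y.
rewrite -[RHS]/(coker_map de (coker_map cd (quot_pi (range (f c)) y))).
by rewrite !coker_map_pi (rc_map_comp cd de).
Qed.

Definition coker : rcmod R C := RCMod coker_map_id coker_map_comp.

Lemma coker_pi_nat c d (cd : (c <= d)%O) :
  quot_pi (range (f d)) \o rc_map N cd =1
  rc_map coker cd \o quot_pi (range (f c)).
Proof. by move=> y; rewrite [RHS]coker_map_pi. Qed.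

Definition coker_pi : rchom N coker :=
  @RCHom _ _ _ N coker (fun c => quot_pi (range (f c))) coker_pi_nat.

Lemma zero_nat c d (cd : (c <= d)%O) :
  (\0 : {linear N d -> coker d}) \o rc_map N cd =1
  rc_map coker cd \o (\0 : {linear N c -> coker c}).
Proof. by move=> y; rewrite [RHS]raddf0. Qed.

Definition coker_zero : rchom N coker :=
  @RCHom _ _ _ N coker (fun c => \0) zero_nat.

Lemma rc_epiP : rc_epi f <-> forall c, epi (f c).
Proof.
split=> [ef c|ef P g h gh c]; last exact/ef/gh.
apply/epiP => y; apply: spanned_range; rewrite -[y]subr0; apply/quot_piP.
(* Being natural, the projection to [coker] and the zero map can be compared at all objects at once
   through [ef]. *)
rewrite raddf0; move: c y; refine (ef coker coker_pi coker_zero _) => c x.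
rewrite -[RHS](raddf0 (quot_pi (range (f c)))); apply/quot_piP.
by rewrite subr0; apply: spanned_gen; exists x.
Qed.

End Cokernel.

Variables (M : rcmod R C) (S : set C).

Lemma gen_map_colim_to c s (sS : s \in S) (sD : s \in below S c) (x : M s)
    (sc : (s <= c)%O) :
  gen_map M S c (@generator _ _ _ M S (SigSub sS) c x sc) =
  colim_to M (@below_le _ _ S c) (@colim_in _ _ _ M _ (SigSub sD) x).
Proof.
rewrite gen_map_generator colim_lift_in /colim_leg /=.
by rewrite (bool_irrelevance (below_le _) sc).
Qed.

(** The two sources have matching generators with equal images in [M c], so two maps out of [M c]
    agree after one exactly when they agree after the other. *)
Lemma gen_map_epi c :
  epi (gen_map M S c) <-> epi (colim_to M (@below_le _ _ S c)).
Proof.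
split=> e W g h gh; apply: e.
  apply: (generators_ext (f := g \o gen_map M S c) (g := h \o gen_map M S c)).
  case=> s sS x sc.
  have sD : s \in below S c by apply/mem_set; split=> //; exact: set_mem.
  rewrite -[LHS]/(g _) -[RHS]/(h _) (gen_map_colim_to sS sD).
  exact: gh.
apply: (colim_ext (f := g \o colim_to M _) (g := h \o colim_to M _)).
case=> s sD x; have [/mem_set sS sc] := set_mem sD.
rewrite -[LHS]/(g (colim_to M _ _)) -[RHS]/(h (colim_to M _ _)).
by rewrite -(gen_map_colim_to sS sD x sc); exact: gh.
Qed.

(** The inverse is the colimit leg at [c]: compatibility of the legs pushes every element of the
    colimit into it. *)
Lemma colim_to_max_iso (D : set C) c (Dc : forall d, D d -> (d <= c)%O) :
  D c -> iso (colim_to M Dc).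
Proof.
move=> cD; pose t : D := SigSub (mem_set cD).
exists (colim_in M t); split=> [z|x]; last first.
  by rewrite [LHS]colim_lift_in [LHS]rc_map_id.
apply: (colim_ext (f := colim_in M t \o colim_to M Dc) (g := idfun)) => d x.
rewrite -[LHS]/(colim_in M t (colim_to M Dc (colim_in M d x))).
by rewrite colim_lift_in; exact: (colim_in_nat (e := t)).
Qed.

Lemma lambda_iso_below c : ~ S c ->
  (iso (colim_to M (@below_le _ _ S c)) <-> iso (lambda M S c)) /\
  (epi (colim_to M (@below_le _ _ S c)) <-> epi (lambda M S c)).
Proof.
move=> nSc; rewrite /lambda.
(* The bounds are generalised so that the index set in their types can be rewritten; afterwards they
   are two proofs of one proposition. *)
move: (@below_le _ _ S c) (@strictly_below_le _ _ S c).
have -> : strictly_below S c = below S c.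
  apply/seteqP; split=> d [] => [/ltW|Sd dc]; first by [].
  by split=> //; rewrite lt_neqAle dc andbT; apply/eqP => dE; rewrite -dE in nSc.
by move=> p q; rewrite (Prop_irrelevance p q).
Qed.

Lemma S_generatedP :
  S_generated M S <-> forall c, ~ S c -> epi (lambda M S c).
Proof.
rewrite /S_generated rc_epiP; split=> [e c nSc|e c].
  by apply/(lambda_iso_below nSc).2/gen_map_epi/e.
apply/gen_map_epi; have [Sc|nSc] := pselect (S c).
  exact/iso_epi/colim_to_max_iso.
exact/(lambda_iso_below nSc).2/e.
Qed.

Lemma S_presentedP :
  S_presented M S <-> forall c, ~ S c -> iso (lambda M S c).
Proof.
split=> [p c nSc|p c]; first exact/(lambda_iso_below nSc).1/p.
have [Sc|nSc] := pselect (S c); first exact: colim_to_max_iso.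
exact/(lambda_iso_below nSc).1/p.
Qed.

End Functors.

Theorem proposition3p9 (R : comPzRingType) (disp : Order.disp_t)
    (C : porderType disp) (M : rcmod R C) (S : set C) :
  (S_generated M S <-> births M S `<=` S) /\
  (S_presented M S <-> births M S `|` deaths M S `<=` S).
Proof.
rewrite S_generatedP S_presentedP; split; split=> [H c|H c nSc].
- by move=> b; apply: contrapT => /H.
- by apply: contrapT => /H.
- by move=> bd; apply: contrapT => /H i; case: bd; apply;
    [exact: iso_epi|exact: iso_mono].
(* A failure of [mono] would be a death and a failure of [epi] a birth; either would force [c] into
   [S]. *)
- by apply: mono_epi_iso; apply: contrapT => b; apply: nSc; apply: H;
    [right|left].
Qed.
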